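(* Let $m>0$ and $n$ be real numbers and let $k\ge 1$ be an integer with $n-m>k$. If $\beta=1$, $a=1$, $b=n-m$ and $c=1$, then the factorial moment of order $k$ of $\mathcal{GNB\text{-}BE}(m,\beta,a,b,c)$ reduces to the factorial moment of order $k$ of the Waring distribution, which is $$\mu_{[k]}=\frac{m_{(k)}\,k!}{(n-m-1)(n-m-2)\cdots(n-m-k)}.$$
   Context: For $r,s>0$, $B(r,s)=\frac{\Gamma(r)\Gamma(s)}{\Gamma(r+s)}$. For $u>0$ and integer $s\ge 0$, $u_{(s)}=\frac{\Gamma(u+s)}{\Gamma(u)}$. For real $y$ and integer $x\ge 0$, $\binom{y}{x}=\frac{y(y-1)\cdots(y-x+1)}{x!}$. The generalized negative binomial distribution $\mathcal{GNB}(m,\beta,\theta)$ has probability mass function $\frac{m}{m+\beta x}\binom{m+\beta x}{x}(1-\theta)^{x}\theta^{m+\beta x-x}$, $x=0,1,2,\dots$. The beta exponential distribution $\mathcal{BE}(a,b,c)$, $a,b,c>0$, has density $g(\lambda;a,b,c)=\frac{c}{B(a,b)}e^{-bc\lambda}(1-e^{-c\lambda})^{a-1}$ for $\lambda>0$. The distribution $\mathcal{GNB\text{-}BE}(m,\beta,a,b,c)$ is the mixture defined by $X\mid\lambda\sim\mathcal{GNB}(m,\beta,\theta=e^{-\lambda})$, $\lambda\sim\mathcal{BE}(a,b,c)$: its mass function is $$p(x)=\int_0^\infty \frac{m}{m+\beta x}\binom{m+\beta x}{x}(1-e^{-\lambda})^{x}e^{-\lambda(m+\beta x-x)}\,g(\lambda;a,b,c)\,d\lambda,\qquad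 x=0,1,2,\dots$$ The Waring distribution with parameters $m>0$, $n>m$ has mass function $\frac{(n-m)\Gamma(m+x)\Gamma(n)}{\Gamma(m)\Gamma(n+x+1)}$, $x=0,1,2,\dots$. The factorial moment of order $k$ is $\mu_{[k]}=E[X(X-1)\cdots(X-k+1)]$. *)

(* Defs.v *)
From HB Require Import structures.
From mathcomp Require Import all_boot all_order all_algebra.
From mathcomp Require Import all_classical all_reals all_analysis.

Set Implicit Arguments.
Unset Strict Implicit.
Unset Printing Implicit Defensive.

Import Order.TTheory GRing.Theory Num.Theory.
Import numFieldNormedType.Exports.

Local Open Scope classical_set_scope.
Local Open Scope ring_scope.

Section special_functions.
Context {R : realType}.
Implicit Types (r s u y : R).

(* Euler's integral; meaningful for 0 < r, where it converges. *)
Definition Gamma r : R :=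
  \int[@lebesgue_measure R]_(t in `]0, +oo[) (t `^ (r - 1) * expR (- t)).

(* The Beta function at real arguments ([beta_fun] in the library only takes
   natural numbers). *)
Definition Beta r s : R := Gamma r * Gamma s / Gamma (r + s).

Definition ascending_factorial u (s : nat) : R := Gamma (u + s%:R) / Gamma u.

Definition binomR y (x : nat) : R := (\prod_(i < x) (y - i%:R)) / x`!%:R.

End special_functions.

Section distributions.
Context {R : realType}.
Implicit Types (m n beta theta a b c lambda : R) (x : nat).

Definition gnb_pmf m beta theta x : R :=
  m / (m + beta * x%:R) * binomR (m + beta * x%:R) x
  * (1 - theta) ^+ x * theta `^ (m + beta * x%:R - x%:R).

(* Density on the half-line 0 < lambda only. *)
Definition be_pdf a b c lambda : R :=
  c / Beta a b * expR (- (b * c * lambda))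
  * (1 - expR (- (c * lambda))) `^ (a - 1).

Definition gnb_be_pmf m beta a b c x : R :=
  \int[@lebesgue_measure R]_(lambda in `]0, +oo[)
     (gnb_pmf m beta (expR (- lambda)) x * be_pdf a b c lambda).

Definition waring_pmf m n x : R :=
  (n - m) * Gamma (m + x%:R) * Gamma n / (Gamma m * Gamma (n + x%:R + 1)).

End distributions.

Section counting_variables.
Context d (T : measurableType d) (R : realType) (P : probability T R).

Definition has_pmf (X : {RV P >-> nat}) (p : nat -> R) : Prop :=
  forall x : nat, distribution P X [set x] = (p x)%:E.

(* Expectations are extended reals, so an equation
   [factorial_moment X k = v%:E] includes the finiteness of the moment. *)
Definition factorial_moment (X : {RV P >-> nat}) (k : nat) : \bar R :=
  'E_P[fun w => \prod_(i < k) ((X w)%:R - i%:R)].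

End counting_variables.

(* Main.v *)
Require Import Defs.
From mathcomp Require Import all_boot all_order all_algebra.
From mathcomp Require Import all_classical all_reals all_analysis.
From mathcomp Require Import measurable_realfun ring lra.
Import Order.TTheory GRing.Theory Num.Theory.
Import numFieldNormedType.Exports.
Local Open Scope classical_set_scope.
Local Open Scope ring_scope.

(** Write u_(x) for the rising factorial u (u + 1) ... (u + x - 1), and let
    m > 0 and n > m.

    For beta = a = c = 1 and b = n - m the mixing law is exponential of rate
    n - m, and the generalized negative binomial law is the ordinary one, with
    mass m_(x) / x! (1 - theta)^x theta^m.  The mixture integral is then a
    Beta integral,
      int_0^oo (1 - e^-t)^x e^(-n t) dt = x! / n_(x+1)
    ([integral_beta_exponential]), so that the mass at x is
    (n - m) m_(x) / n_(x+1).  The functional equation of Gamma turns the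
    Waring mass function into the same expression ([waring_pmfE]).  The two
    factorial moments therefore agree, since each is the series of
    x (x - 1) ... (x - k + 1) against the mass function
    ([factorial_moment_series]).

    The common value comes from summation by parts.  The Waring mass
    telescopes, because
      (n - m) m_(x) / n_(x+1) = t(x) - t(x + 1)   with   t(x) = m_(x) / n_(x),
    and differencing the falling factorial of order k + 1 gives k + 1 times
    the one of order k.  With S_k(m) the sum over x of
    x (x - 1) ... (x - k + 1) m_(x) / n_(x+1), this yields
      (n - m) S_(k+1)(m) = (k + 1) m S_k(m + 1),
    provided that the boundary term N (N - 1) ... (N - k) t(N) vanishes at
    infinity.  It is at most a constant times (m + k + 1)_(N) / n_(N), which
    tends to 0 when m + k + 1 < n, because the harmonic series diverges
    ([rising_ratio_cvg0]).  Iterating gives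
      S_k(m) = m_(k) k! / ((n - m) (n - m - 1) ... (n - m - k))
    ([waring_ffact_sum_cvg]).

    The functional equation and the positivity of Gamma are obtained from
    Euler's integral, by parts on an exhaustion of the half-line by compact
    intervals ([gamma_integral_succ], [Gamma_gt0]). *)

(** * Exponential integrals on the half-line *)

Section ExponentialIntegrals.
Context {R : realType}.
Notation mu := (@lebesgue_measure R).

(** The exponential density of rate [r] has total mass 1. *)
Lemma integral_expR_decay (r : R) : 0 < r ->
  (\int[mu]_(t in `]0%R, +oo[) (expR (- (r * t)))%:E = (r^-1)%:E)%E.
Proof.
move=> r0; rewrite integral_itv_obnd_cbnd; last first.
  apply/measurable_EFinP; apply: measurableT_comp => //.
  by apply: measurable_funN; exact: measurable_funM.
transitivity (\int[mu]_(t in `[0%R, +oo[)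
    (r^-1%:E * (exponential_pdf r t)%:E))%E.
  apply: eq_integral => t; rewrite inE/= in_itv/= andbT => t0.
  by rewrite exponential_pdfE// -EFinM mulrA mulVf ?gt_eqF// mul1r mulNr.
rewrite ge0_integralZl_EFin ?invr_ge0 ?ltW//; last 2 first.
- by move=> t _; rewrite lee_fin exponential_pdf_ge0 ?ltW.
- apply/measurable_EFinP; apply: measurable_funTS.
  exact: measurable_exponential_pdf.
have := integral_exponential_pdf r0.
rewrite [in X in X -> _](_ : \int[mu]_x _ =
    \int[mu]_(x in `[0%R, +oo[) (exponential_pdf r x)%:E)%E.
  by move=> ->; rewrite mule1.
rewrite [RHS]integral_mkcond; apply: eq_integral => t _.
rewrite patchE; case: ifPn => //; rewrite /exponential_pdf.
by move=> /negbTE t0; rewrite patchE t0.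
Qed.

Lemma integrable_expR_decay (r : R) : 0 < r ->
  mu.-integrable `]0, +oo[ (EFin \o (fun t => expR (- (r * t)))).
Proof.
move=> r0; apply/integrableP; split.
  apply/measurable_EFinP; apply: measurableT_comp => //.
  by apply: measurable_funN; exact: measurable_funM.
under eq_integral do rewrite /= ger0_norm ?expR_ge0//.
by rewrite integral_expR_decay// ltry.
Qed.

Lemma Rintegral_expR_decay (r : R) : 0 < r ->
  \int[mu]_(t in `]0, +oo[) expR (- (r * t)) = r^-1.
Proof. by move=> r0; rewrite /Rintegral integral_expR_decay. Qed.

Lemma integrable_beta_exponential (x : nat) (r : R) : 0 < r ->
  mu.-integrable `]0, +oo[
    (EFin \o (fun t => (1 - expR (- t)) ^+ x * expR (- (r * t)))).
Proof.
move=> r0; apply: le_integrable (integrable_expR_decay _ r0) => //.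
  apply/measurable_EFinP; apply: measurable_funM.
    apply: measurable_funX; apply: measurable_funB => //.
    by apply: measurableT_comp => //; exact: measurable_funN.
  apply: measurableT_comp => //.
  by apply: measurable_funN; exact: measurable_funM.
move=> t; rewrite /= in_itv/= andbT => t0; rewrite lee_fin.
have ? : 0 <= 1 - expR (- t) by rewrite subr_ge0 expR_le1 oppr_le0 ltW.
rewrite normrM ler_piMl// normrX ger0_norm// exprn_ile1//.
Qed.

End ExponentialIntegrals.

(** * The functional equation and the positivity of Gamma *)

Section GammaFunction.
Context {R : realType}.
Notation mu := (@lebesgue_measure R).
Implicit Types (r t : R).

Definition gamma_integrand r t : R := t `^ (r - 1) * expR (- t).

Lemma gamma_integrand_ge0 r t : 0 <= gamma_integrand r t.
Proof. by rewrite mulr_ge0 ?powR_ge0 ?expR_ge0. Qed.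

Lemma measurable_gamma_integrand r (D : set R) :
  measurable_fun D (EFin \o gamma_integrand r).
Proof.
apply/measurable_EFinP; apply: measurable_funTS; apply: measurable_funM.
  exact: measurable_powR.
by apply: measurableT_comp => //; exact: measurable_funN.
Qed.

Lemma continuous_gamma_integrand r a b : 0 < a ->
  {within `[a, b], continuous (gamma_integrand r)}.
Proof.
move=> a0; apply: derivable_within_continuous => t.
rewrite in_itv/= => /andP[+ _] => /(lt_le_trans a0) t0.
apply: derivableM; last first.
  by apply: ex_derive.
by apply: derivable_powR; rewrite ?in_itv/= ?t0 ?oner_eq0.
Qed.

(** From the term of degree p + 1 of the exponential series,
    e^(c t) >= (c t)^(p+1) / (p + 1)!, while t^r <= t^p for t >= 1. *)
Lemma powR_expR_bound (c : R) (p : nat) : 0 < c ->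
  exists2 M : R, 0 < M & forall r t, r <= p%:R -> 1 <= t ->
    t `^ r * expR (- (c * t)) <= M / t.
Proof.
move=> c0; exists (p.+1`!%:R / c ^+ p.+1).
  by rewrite divr_gt0 ?exprn_gt0// ltr0n fact_gt0.
move=> r t rp t1; have t0 : 0 < t by apply: lt_le_trans t1.
have ct0 : 0 <= c * t by rewrite mulr_ge0 ?ltW.
have h : (c * t) ^+ p.+1 / p.+1`!%:R <= expR (c * t).
  by apply: le_trans (expR_ge1Dxn p ct0); rewrite lerDr.
rewrite expRN ler_pdivrMr ?expR_gt0//.
apply: (@le_trans _ _ (t ^+ p)).
  by rewrite -powR_mulrn ?(ltW t0)// ler_powR.
apply: le_trans (ler_wpM2l _ h); last first.
  by rewrite ?divr_ge0 ?ltW// ?exprn_gt0// ltr0n fact_gt0.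
rewrite exprMn (exprS t p) le_eqVlt; apply/orP; left; apply/eqP.
have C0 : c ^+ p.+1 != 0 by rewrite gt_eqF ?exprn_gt0.
have K0 : p.+1`!%:R != 0 :> R by rewrite gt_eqF ?ltr0n ?fact_gt0.
move: (c ^+ p.+1) (p.+1`!%:R) (t ^+ p) C0 K0 => C K T C0 K0.
by field; rewrite C0 K0 gt_eqF.
Qed.

(* The integrand is continuous on these intervals even when [r < 1], where it
   is unbounded at 0. *)
Let cut n : set R := `[n.+2%:R^-1, n.+2%:R]%classic.

Let cut_union : \bigcup_n cut n = `]0, +oo[%classic.
Proof.
apply/seteqP; split => t /=.
  move=> [n _]; rewrite /cut/= !in_itv/= andbT => /andP[+ _].
  by apply: lt_le_trans; rewrite invr_gt0.
rewrite in_itv/= andbT => t0.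
pose N := maxn (Num.truncn t) (Num.truncn t^-1).
exists N => //; rewrite /cut/= in_itv/=.
have h (x : R) : x < (Num.truncn x).+1%:R by rewrite truncnS_gt.
apply/andP; split.
  rewrite -[leRHS]invrK lef_pV2 ?posrE ?invr_gt0//.
  apply: le_trans (ltW (h _)) _; rewrite ler_nat ltnS leqW// leq_maxr//.
apply: le_trans (ltW (h _)) _; rewrite ler_nat ltnS leqW// leq_maxl//.
Qed.

Lemma gamma_cut_cvg r :
  (\int[mu]_(t in cut n) (gamma_integrand r t)%:E @[n --> \oo])%E -->
  (\int[mu]_(t in `]0%R, +oo[) (gamma_integrand r t)%:E)%E.
Proof.
rewrite -cut_union; apply: ge0_nondecreasing_set_cvg_integral.
- move=> i j ij; apply/subsetPset => t; rewrite /cut/= !in_itv/= => /andP[it ti].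
  rewrite (le_trans _ it) ?(le_trans ti) ?ler_nat// ?lef_pV2 ?posrE//.
  by rewrite ler_nat.
- by move=> n; exact: measurable_itv.
- by move=> n; exact: measurable_gamma_integrand.
- by move=> n t _; rewrite lee_fin gamma_integrand_ge0.
Qed.

Lemma gamma_cut_by_parts r n :
  (\int[mu]_(t in cut n) (gamma_integrand (r + 1) t)%:E =
   (n.+2%:R^-1 `^ r * expR (- n.+2%:R^-1) - n.+2%:R `^ r * expR (- n.+2%:R))%:E
     + r%:E * \int[mu]_(t in cut n) (gamma_integrand r t)%:E)%E.
Proof.
have a0 : 0 < n.+2%:R^-1 :> R by rewrite invr_gt0.
have ab : n.+2%:R^-1 < n.+2%:R :> R.
  by rewrite invf_plt ?posrE// (@lt_trans _ _ 1) ?invf_lt1// ltr1n.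
have gi s : mu.-integrable (cut n) (EFin \o gamma_integrand s).
  apply: continuous_compact_integrable; first exact: segment_compact.
  exact: continuous_gamma_integrand.
have fin s : (\int[mu]_(t in cut n) (gamma_integrand s t)%:E)%E \is a fin_num.
  by apply: integrable_fin_num (gi s); exact: measurable_itv.
rewrite -(fineK (fin r)) -(fineK (fin (r + 1))) -EFinM -EFinD.
congr EFin.
have pos t : n.+2%:R^-1 <= t -> 0 < t by apply: lt_le_trans.
have dpow s t : 0 < t -> derivable (fun t => t `^ s) t 1.
  by move=> t0; apply: derivable_powR; rewrite ?in_itv/= ?t0 ?oner_eq0.
have dexp t : is_derive t 1 (fun t : R => - expR (- t)) (expR (- t)).
  by apply: is_derive_eq; rewrite mulrN1 opprK.
have LR (G : R -> R) (dG : forall t, 0 < t -> derivable G t 1) :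
    derivable_oo_LRcontinuous G n.+2%:R^-1 n.+2%:R.
  have cG t : 0 < t -> {for t, continuous G}.
    by move=> t0; apply: differentiable_continuous; apply/derivable1_diffP/dG.
  split.
  - by move=> t; rewrite in_itv/= => /andP[/ltW/pos t0 _]; exact: dG.
  - by apply: cvg_at_right_filter; exact: cG.
  - by apply: cvg_at_left_filter; apply: cG; exact: lt_trans ab.
have E : \int[mu]_(t in cut n) gamma_integrand (r + 1) t =
    \int[mu]_(t in cut n) (t `^ r * expR (- t)).
  by apply: eq_Rintegral => t _; rewrite /gamma_integrand addrK.
transitivity (\int[mu]_(t in cut n) gamma_integrand (r + 1) t); first by [].
rewrite E (@Rintegration_by_parts R (fun t => t `^ r) (fun t => - expR (- t))
  (fun t => r * t `^ (r - 1)) (fun t => expR (- t)))//.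
- have -> : \int[mu]_(t in cut n) (r * t `^ (r - 1) * - expR (- t)) =
      - r * \int[mu]_(t in cut n) gamma_integrand r t.
    rewrite -RintegralZl; [|exact: measurable_itv|exact: gi].
    by apply: eq_Rintegral => t _; rewrite /gamma_integrand; ring.
  by rewrite /Rintegral; ring.
- apply: derivable_within_continuous => t.
  by rewrite in_itv/= => /andP[/pos t0 _]; apply: derivableM => //; exact: dpow.
- by apply: LR => t; exact: dpow.
- move=> t; rewrite in_itv/= => /andP[/ltW/pos t0 _].
  by rewrite powR_derive1// in_itv/= t0.
- by apply: derivable_within_continuous => t _; exact: ex_derive.
- by apply: LR => t _; exact: ex_derive.
- by move=> t _; rewrite derive1E; exact: derive_val.
Qed.

(** Stated for extended-real integrals, where monotone convergence applies
    before any finiteness is known; finiteness for [r < 1] is then deduced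
    from this very equation. *)
Lemma gamma_integral_succ r : 0 < r ->
  (\int[mu]_(t in `]0%R, +oo[) (gamma_integrand (r + 1) t)%:E =
   r%:E * \int[mu]_(t in `]0%R, +oo[) (gamma_integrand r t)%:E)%E.
Proof.
move=> r0; apply: cvg_unique (gamma_cut_cvg (r + 1)) _ => //.
rewrite (funext (gamma_cut_by_parts r)).
rewrite -(add0e (r%:E * _)%E).
have inv0 : (n.+2%:R^-1 : R) @[n --> \oo] --> 0.
  by have := @cvg_harmonic R; rewrite -cvg_shiftS.
apply: cvgeD; [by rewrite fin_num_adde_defr| |]; last first.
  by apply: cvgeZl => //; exact: gamma_cut_cvg.
apply: cvg_EFin; first exact: nearW.
rewrite /comp/= -[X in _ --> X]subr0; apply: cvgB.
- apply: (@squeeze_cvgr _ _ _ _ (fun=> 0) (fun n => n.+2%:R^-1 `^ r)).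
  + near=> n; apply/andP; split; first by rewrite mulr_ge0 ?powR_ge0 ?expR_ge0.
    by rewrite ler_piMr ?powR_ge0// expR_le1 oppr_le0 invr_ge0.
  + exact: cvg_cst.
  + by have /cvg_at_rightP := powR_cvg0 r0; apply; split.
- have [M M0 HM] := @powR_expR_bound 1 (Num.truncn r).+1 ltr01.
  apply: (@squeeze_cvgr _ _ _ _ (fun=> 0) (fun n => M * n.+2%:R^-1)).
  + near=> n; apply/andP; split; first by rewrite mulr_ge0 ?powR_ge0 ?expR_ge0.
    have := HM r n.+2%:R; rewrite mul1r; apply; last by rewrite ler1n.
    by rewrite ltW ?truncnS_gt.
  + exact: cvg_cst.
  + by rewrite -(mulr0 M); apply: cvgMr.
Unshelve. all: by end_near. Qed.

(** By the functional equation it suffices to treat [r + 1], whose integrand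
    t^r e^-t is bounded by a multiple of e^(-t/2) on the whole half-line. *)
Lemma gamma_integrable r : 0 < r ->
  mu.-integrable `]0, +oo[ (EFin \o gamma_integrand r).
Proof.
move=> r0; apply/integrableP; split; first exact: measurable_gamma_integrand.
under eq_integral do rewrite /= ger0_norm ?gamma_integrand_ge0//.
suff : (r%:E * \int[mu]_(t in `]0%R, +oo[) (gamma_integrand r t)%:E < +oo)%E.
  have : (0 <= \int[mu]_(t in `]0%R, +oo[) (gamma_integrand r t)%:E)%E.
    by apply: integral_ge0 => t _; rewrite lee_fin gamma_integrand_ge0.
  case: (\int[_]_(_ in _) _)%E => //; first by move=> *; exact: ltry.
  by rewrite gt0_muley// lte_fin.
rewrite -gamma_integral_succ//.
have h0 : 0 < (2^-1 : R) by rewrite invr_gt0.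
have [M M0 HM] := @powR_expR_bound 2^-1 (Num.truncn r).+1 h0.
apply: (@le_lt_trans _ _ (\int[mu]_(t in `]0%R, +oo[)
    ((1 + M)%:E * (expR (- (2^-1 * t)))%:E))%E).
  apply: ge0_le_integral => //.
  - by move=> t _; rewrite lee_fin gamma_integrand_ge0.
  - exact: measurable_gamma_integrand.
  - apply/measurable_EFinP; apply: measurable_funM => //.
    apply: measurableT_comp => //.
    by apply: measurable_funN; exact: measurable_funM.
  move=> t; rewrite /= in_itv/= andbT => t0; rewrite -EFinM lee_fin.
  rewrite /gamma_integrand addrK.
  have -> : expR (- t) = expR (- (2^-1 * t)) * expR (- (2^-1 * t)).
    by rewrite -expRD; congr expR; field.
  rewrite mulrA ler_pM2r ?expR_gt0//.
  have [t1|t1] := leP 1 t.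
    apply: le_trans (HM r t _ t1) _; first by rewrite ltW ?truncnS_gt.
    by rewrite ler_wpDl// ler_piMr ?(ltW M0)// invf_le1.
  apply: (@le_trans _ _ (1 * 1)); last by rewrite mulr1 lerDl ltW.
  apply: ler_pM; rewrite ?powR_ge0 ?expR_ge0//.
    have : t `^ r <= 1 `^ r by apply: ge0_ler_powR; rewrite ?nnegrE ?ltW.
    by rewrite powR1.
  by rewrite expR_le1 oppr_le0 mulr_ge0 ?ltW.
rewrite ge0_integralZl_EFin//.
- by rewrite integral_expR_decay// -EFinM ltry.
- apply/measurable_EFinP; apply: measurableT_comp => //.
  by apply: measurable_funN; exact: measurable_funM.
- by rewrite addr_ge0 ?ltW.
Qed.

Lemma GammaE r : Gamma r = \int[mu]_(t in `]0, +oo[) gamma_integrand r t.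
Proof. by []. Qed.

Lemma Gamma_succ r : 0 < r -> Gamma (r + 1) = r * Gamma r.
Proof.
move=> r0; rewrite !GammaE -RintegralZl//; last exact: gamma_integrable.
rewrite /Rintegral gamma_integral_succ// -ge0_integralZl_EFin ?ltW//.
- by move=> t _; rewrite lee_fin gamma_integrand_ge0.
- exact: measurable_gamma_integrand.
Qed.

(** By the functional equation it suffices to treat [r + 1], whose integrand
    t^r e^-t is at least e^-2 on [1, 2]. *)
Lemma Gamma_gt0 r : 0 < r -> 0 < Gamma r.
Proof.
move=> r0; rewrite -(pmulr_rgt0 _ r0) -Gamma_succ//.
apply: (@lt_le_trans _ _ (\int[mu]_(t in `[1, 2]) expR (- 2))).
  have m12 : mu `[1, 2] = 1%:E.
    by rewrite lebesgue_measure_itv/= lte_fin ltr1n -EFinB; congr EFin; ring.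
  by rewrite Rintegral_cst// [X in fine X]m12 mulr1 expR_gt0.
rewrite GammaE.
rewrite -lee_fin /Rintegral !fineK; last 2 first.
- by apply: integrable_fin_num => //; exact/gamma_integrable/addr_gt0.
- apply: integrable_fin_num => //; apply: continuous_compact_integrable.
    exact: segment_compact.
  by apply: continuous_subspaceT => t; exact: cst_continuous.
apply: (@le_trans _ _
  (\int[mu]_(t in `[1%R, 2%R]) (gamma_integrand (r + 1) t)%:E)%E).
  apply: ge0_le_integral => //.
  - exact: measurable_gamma_integrand.
  move=> t; rewrite /= in_itv/= => /andP[t1 t2]; rewrite lee_fin.
  rewrite /gamma_integrand addrK -[leLHS]mul1r; apply: ler_pM => //.
  - by rewrite -[leLHS](powRr0 t) ler_powR// ltW.
  - by rewrite ler_expR lerN2.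
apply: ge0_subset_integral => //.
- exact: measurable_gamma_integrand.
- by move=> t _; rewrite lee_fin gamma_integrand_ge0.
- by move=> t; rewrite /= !in_itv/= andbT => /andP[+ _]; exact: lt_le_trans.
Qed.

End GammaFunction.

(** * Rising and falling factorials *)

Section Rising.
Context {R : realType}.
Implicit Types (u m n : R) (x k N : nat).

(** The Pochhammer symbol, as a product: unlike a quotient of Gamma values it
    can be handled by algebra alone. *)
Definition rising u x : R := \prod_(i < x) (u + i%:R).

Lemma rising0 u : rising u 0 = 1.
Proof. by rewrite /rising big_ord0. Qed.

Lemma risingSr u x : rising u x.+1 = rising u x * (u + x%:R).
Proof. by rewrite /rising big_ord_recr. Qed.

Lemma risingD u x k : rising u (x + k) = rising u x * rising (u + x%:R) k.
Proof.
elim: k => [|k IHk]; first by rewrite addn0 rising0 mulr1.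
by rewrite addnS !risingSr IHk mulrA natrD addrA.
Qed.

Lemma risingS u x : rising u x.+1 = u * rising (u + 1) x.
Proof. by rewrite -add1n risingD /rising big_ord1 addr0. Qed.

Lemma rising_gt0 u x : 0 < u -> 0 < rising u x.
Proof. by move=> u0; apply: prodr_gt0 => i _; rewrite ltr_wpDr. Qed.

(** The product has a zero factor when [y < k], where the truncated falling
    factorial vanishes as well. *)
Lemma ffact_prod y k : \prod_(i < k) (y%:R - i%:R) = (y ^_ k)%:R :> R.
Proof.
elim: k => [|k IHk]; first by rewrite big_ord0 ffactn0.
rewrite big_ord_recr/= IHk ffactnSr natrM.
have [ky|yk] := leqP k y; first by rewrite natrB.
by rewrite ffact_small// !mul0r.
Qed.

Lemma ffact_le_rising u y k : 0 <= u -> (y ^_ k)%:R <= rising (u + y%:R) k.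
Proof.
move=> u0; elim: k => [|k IHk]; first by rewrite ffactn0 rising0.
rewrite ffactnSr natrM risingSr; apply: ler_pM => //.
rewrite (@le_trans _ _ y%:R) ?ler_nat ?leq_subr//.
by rewrite -addrA addrCA lerDl addr_ge0.
Qed.

Lemma series_harmonic_ge0 N : 0 <= series (@harmonic R) N.
Proof. by rewrite seriesEord; apply: sumr_ge0 => i _; exact: harmonic_ge0. Qed.

(** The inverse ratio is the product of the 1 + (n - u) / (u + i), hence at
    least 1 plus the sum of the (n - u) / (u + i), which dominates a multiple
    of the harmonic series. *)
Lemma rising_ratio_cvg0 u n : 0 < u -> u < n ->
  rising u N / rising n N @[N --> \oo] --> 0.
Proof.
move=> u0 un; have n0 := lt_trans u0 un.
(* [M] is chosen so that u + i <= M (i + 1) for all i. *)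
pose M := Num.max u 1; pose c := (n - u) / M.
have M0 : 0 < M by rewrite lt_max u0.
have c0 : 0 < c by rewrite divr_gt0// subr_gt0.
have key N : 1 + c * series harmonic N <= rising n N / rising u N.
  elim: N => [|N IHN].
    by rewrite /series/= big_geq// mulr0 addr0 !rising0 divr1.
  rewrite seriesSr/= mulrDr addrA !risingSr invfM.
  have uN : 0 < u + N%:R by rewrite ltr_wpDr.
  have h : c * N.+1%:R^-1 <= (n - u) / (u + N%:R).
    rewrite /c -mulrA ler_pM2l ?subr_gt0// -invfM lef_pV2 ?posrE ?mulr_gt0//.
    rewrite -natr1 mulrDr mulr1 addrC lerD ?le_max ?lexx//.
    by rewrite ler_peMl// le_max lexx orbT.
  have ge1 : 1 <= rising n N / rising u N.
    apply: le_trans IHN; rewrite lerDl mulr_ge0 ?(ltW c0)//.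
    exact: series_harmonic_ge0.
  have -> : rising n N * (n + N%:R) * ((rising u N)^-1 * (u + N%:R)^-1) =
      rising n N / rising u N + rising n N / rising u N * ((n - u) / (u + N%:R)).
    field; rewrite ?gt_eqF ?rising_gt0//.
  rewrite lerD// (le_trans h)// ler_peMl// divr_ge0 ?subr_ge0 ?ltW//.
have H : series (@harmonic R) @ \oo --> +oo.
  apply: nondecreasing_dvgn_lt; last exact: dvg_harmonic.
  by apply: nondecreasing_series => i _ _; exact: harmonic_ge0.
apply: (@squeeze_cvgr _ _ _ _ (fun=> 0)
  (fun N => (1 + c * series harmonic N)^-1)).
- near=> N; apply/andP; split.
    by rewrite divr_ge0 ?ltW ?rising_gt0.
  have c1 : 0 < 1 + c * series harmonic N.
    by rewrite ltr_wpDr// mulr_ge0 ?(ltW c0)//; exact: series_harmonic_ge0.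
  rewrite -[leLHS]invrK invf_div lef_pV2 ?key// posrE ?divr_gt0 ?rising_gt0//.
- exact: cvg_cst.
- have h0 : \forall N \near \oo, 0 < 1 + c * series harmonic N.
    by near=> N; rewrite ltr_wpDr// mulr_ge0 ?(ltW c0)// series_harmonic_ge0.
  apply/(gtr0_cvgV0 h0).
  apply: (@cvg_comp _ _ _ _ (fun y => 1 + c * y) _ _ _ H).
  by apply: cvg_comp (gt0_cvgMry c0 cvg_id) (cvg_addrl 1).
Unshelve. all: by end_near. Qed.

(** Abel summation, from
    (n - m) m_(x) / n_(x+1) = t(x) - t(x + 1) with t(x) = m_(x) / n_(x).  The
    difference of the falling factorial of order k + 1 is k + 1 times the one
    of order k, and m (m + 1)_(x) / n_(x+1) = t(x + 1). *)
Lemma summation_by_parts_ffact m n k N : 0 < n ->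
  (n - m) * (\sum_(x < N) (x ^_ k.+1)%:R * (rising m x / rising n x.+1)) =
  k.+1%:R * m * (\sum_(x < N) (x ^_ k)%:R * (rising (m + 1) x / rising n x.+1))
  - (N ^_ k.+1)%:R * (rising m N / rising n N).
Proof.
move=> n0; elim: N => [|N IHN].
  by rewrite !big_ord0 !mulr0 ffact_small// mul0r subr0.
rewrite !big_ord_recr/= mulrDr IHN mulrDr.
have nN : n + N%:R != 0 by rewrite gt_eqF// ltr_wpDr.
have rn : rising n N != 0 by rewrite gt_eqF// rising_gt0.
have e1 : (N ^_ k.+1)%:R = (N ^_ k)%:R * (N%:R - k%:R) :> R.
  by rewrite -!ffact_prod big_ord_recr.
have e2 : (N.+1 ^_ k.+1)%:R = (N%:R + 1) * (N ^_ k)%:R :> R.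
  by rewrite ffactSS natrM natr1.
have e3 : m * rising (m + 1) N = rising m N * (m + N%:R).
  by rewrite -risingS risingSr.
rewrite e2 !e1 !risingSr -addrA -[in RHS]addrA; congr (_ + _).
have -> : k.+1%:R * m * ((N ^_ k)%:R *
    (rising (m + 1) N / (rising n N * (n + N%:R)))) =
  k.+1%:R * ((N ^_ k)%:R * (rising m N * (m + N%:R) / (rising n N * (n + N%:R)))).
  by rewrite -e3; field; rewrite nN rn.
rewrite -(natr1 k); field.
by rewrite nN rn.
Qed.

(** The falling factorial of [N] is at most (m + N)_(k), and
    (m + N)_(k) m_(N) = m_(N + k) = m_(k) (m + k)_(N), so the sequence is
    dominated by a multiple of (m + k)_(N) / n_(N). *)
Lemma ffact_tail_cvg0 m n k : 0 < m -> m + k%:R < n ->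
  (N ^_ k)%:R * (rising m N / rising n N) @[N --> \oo] --> 0.
Proof.
move=> m0 mkn; have mk : 0 < m + k%:R by rewrite ltr_wpDr.
have n0 : 0 < n := lt_trans mk mkn.
apply: (@squeeze_cvgr _ _ _ _ (fun=> 0)
  (fun N => rising m k * (rising (m + k%:R) N / rising n N))).
- near=> N; apply/andP; split.
    by rewrite mulr_ge0// divr_ge0 ?ltW ?rising_gt0.
  rewrite [leLHS]mulrA [leRHS]mulrA ler_pM2r ?invr_gt0 ?rising_gt0//.
  rewrite -risingD addnC risingD mulrC.
  by rewrite ler_pM2l ?rising_gt0// ffact_le_rising// ltW.
- exact: cvg_cst.
- by rewrite -(mulr0 (rising m k)); apply: cvgMr; exact: rising_ratio_cvg0.
Unshelve. all: by end_near. Qed.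

(** Summation by parts expresses the sum of order k + 1 at [m] through the sum
    of order k at [m + 1], so the induction on [k] must let [m] vary; the
    condition m + k < n is stable under this exchange. *)
Lemma waring_ffact_sum_cvg m n k : 0 < m -> m + k%:R < n ->
  \sum_(x < N) (x ^_ k)%:R * (rising m x / rising n x.+1) @[N --> \oo] -->
  rising m k * k`!%:R / \prod_(j < k.+1) (n - m - j%:R).
Proof.
elim: k m => [m m0|k IHk m m0 mkn].
  rewrite addr0 => mn; have nm0 : n - m != 0 by rewrite subr_eq0 gt_eqF.
  have n0 := lt_trans m0 mn.
  have -> : (fun N => \sum_(x < N) (x ^_ 0)%:R * (rising m x / rising n x.+1)) =
      (fun N => (n - m)^-1 * (1 - rising m N / rising n N)).
    apply/funext => N; elim: N => [|N IHN].
      by rewrite big_ord0 !rising0 divr1 subrr mulr0.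
    rewrite big_ord_recr/= IHN ffactn0 !risingSr; field.
    by rewrite nm0 !gt_eqF ?ltr_wpDr ?rising_gt0.
  rewrite rising0 fact0 big_ord1 subr0 !mul1r.
  rewrite -[X in _ --> X]mulr1 -[X in _ * X]subr0.
  by apply: cvgMr; apply: cvgB; [exact: cvg_cst|exact: rising_ratio_cvg0].
have mn : m < n by apply: le_lt_trans mkn; rewrite lerDl.
have nm0 : n - m != 0 by rewrite subr_eq0 gt_eqF.
have n0 := lt_trans m0 mn.
have -> : (fun N => \sum_(x < N) (x ^_ k.+1)%:R * (rising m x / rising n x.+1)) =
   (fun N => (n - m)^-1 * (k.+1%:R * m *
       (\sum_(x < N) (x ^_ k)%:R * (rising (m + 1) x / rising n x.+1))
  - (N ^_ k.+1)%:R * (rising m N / rising n N))).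
  by apply/funext => N; rewrite -summation_by_parts_ffact// mulKf.
have -> : rising m k.+1 * k.+1`!%:R / \prod_(j < k.+2) (n - m - j%:R) =
  (n - m)^-1 * (k.+1%:R * m * (rising (m + 1) k * k`!%:R /
     \prod_(j < k.+1) (n - (m + 1) - j%:R)) - 0).
  rewrite subr0 risingS factS natrM big_ord_recl/= subr0 invfM.
  under eq_bigr do rewrite /bump/= natrD opprD addrA -(addrA n) -opprD.
  by rewrite /=; ring.
apply: cvgMr; apply: cvgB; last exact: ffact_tail_cvg0.
apply: cvgMr; apply: IHk; first by rewrite addr_gt0.
by rewrite -addrA nat1r.
Qed.

End Rising.

(** * The two mass functions *)

Section MassFunctions.
Context {R : realType}.
Notation mu := (@lebesgue_measure R).
Implicit Types (m n b r : R) (x : nat).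

Lemma Gamma_rising r x : 0 < r -> Gamma (r + x%:R) = rising r x * Gamma r.
Proof.
move=> r0; elim: x => [|x IHx]; first by rewrite addr0 rising0 mul1r.
by rewrite -natr1 addrA Gamma_succ ?ltr_wpDr// IHx risingSr; ring.
Qed.

Lemma ascending_factorialE r x : 0 < r -> ascending_factorial r x = rising r x.
Proof.
by move=> r0; rewrite /ascending_factorial Gamma_rising// mulfK//
   gt_eqF ?Gamma_gt0.
Qed.

Lemma waring_pmfE m n x : 0 < m -> m < n ->
  waring_pmf m n x = (n - m) * (rising m x / rising n x.+1).
Proof.
move=> m0 mn; have n0 := lt_trans m0 mn.
rewrite /waring_pmf -addrA natr1 !Gamma_rising//; field.
by rewrite !gt_eqF ?Gamma_gt0 ?rising_gt0.
Qed.

(** Writing one factor 1 - e^-t as a difference lowers the exponent: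
    I(x + 1, r) = I(x, r) - I(x, r + 1). *)
Lemma integral_beta_exponential x r : 0 < r ->
  \int[mu]_(t in `]0, +oo[) ((1 - expR (- t)) ^+ x * expR (- (r * t))) =
  x`!%:R / rising r x.+1.
Proof.
elim: x r => [|x IHx] r r0.
  under eq_Rintegral do rewrite expr0 mul1r.
  by rewrite Rintegral_expR_decay// risingSr rising0 fact0 !mul1r addr0.
have r1 : 0 < r + 1 by rewrite addr_gt0.
transitivity (\int[mu]_(t in `]0, +oo[)
  ((1 - expR (- t)) ^+ x * expR (- (r * t)) -
   (1 - expR (- t)) ^+ x * expR (- ((r + 1) * t)))).
  apply: eq_Rintegral => t _.
  by rewrite mulrDl mul1r opprD expRD exprSr; ring.
rewrite RintegralB//; try exact: integrable_beta_exponential.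
rewrite !IHx// factS natrM.
rewrite (risingS r x.+1).
have -> : rising (r + 1) x.+1 = rising r x.+1 / r * (r + x.+1%:R).
  by rewrite -nat1r addrA risingSr risingS; field; rewrite gt_eqF.
rewrite -natr1; field.
by rewrite !gt_eqF ?rising_gt0// -?natr1 ?ltr_wpDr.
Qed.

Lemma falling_shift_rising m x :
  \prod_(i < x) (m + x%:R - i%:R) = rising (m + 1) x.
Proof.
elim: x => [|x IHx]; first by rewrite big_ord0 rising0.
rewrite big_ord_recl risingSr -IHx subr0 mulrC -nat1r addrA; congr (_ * _).
by apply: eq_bigr => i _; rewrite /bump/= -nat1r; ring.
Qed.

(** At beta = 1 the exponent of theta no longer depends on [x], and
    m / (m + x) * (m + 1)_(x) = m_(x). *)
Lemma gnb_pmf_beta1 m x (t : R) : 0 < m ->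
  gnb_pmf m 1 (expR (- t)) x =
  rising m x / x`!%:R * (1 - expR (- t)) ^+ x * expR (- (m * t)).
Proof.
move=> m0; rewrite /gnb_pmf /binomR mul1r falling_shift_rising addrK.
rewrite -expRM mulNr (mulrC t).
congr (_ * _ * _); rewrite !mulrA; congr (_ / _).
have mx : m + x%:R != 0 by rewrite gt_eqF// ltr_wpDr.
apply: (mulIf mx).
by rewrite -risingSr risingS; field.
Qed.

(** Since B(1, b) = Gamma(1) / b, the density is exponential of rate [b]. *)
Lemma be_pdf_a1 b (t : R) : 0 < b -> be_pdf 1 b 1 t = b * expR (- (b * t)).
Proof.
move=> b0; rewrite /be_pdf subrr powRr0 mulr1 mulr1; congr (_ * _).
rewrite /Beta (addrC 1) Gamma_succ//.
have -> : Gamma 1 = 1 :> R.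
  rewrite GammaE -[RHS]invr1 -Rintegral_expR_decay//.
  by apply: eq_Rintegral => s _; rewrite /gamma_integrand subrr powRr0 !mul1r.
by field; rewrite !gt_eqF ?Gamma_gt0.
Qed.

Lemma gnb_be_pmfE m n x : 0 < m -> m < n ->
  gnb_be_pmf m 1 1 (n - m) 1 x = (n - m) * (rising m x / rising n x.+1).
Proof.
move=> m0 mn; have n0 := lt_trans m0 mn.
have b0 : 0 < n - m by rewrite subr_gt0.
transitivity (\int[mu]_(t in `]0, +oo[) ((n - m) * rising m x / x`!%:R *
   ((1 - expR (- t)) ^+ x * expR (- (n * t))))).
  apply: eq_Rintegral => t _; rewrite gnb_pmf_beta1// be_pdf_a1//.
  have -> : expR (- (n * t)) = expR (- (m * t)) * expR (- ((n - m) * t)).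
    by rewrite -expRD; congr expR; ring.
  by ring.
rewrite RintegralZl//; last exact: integrable_beta_exponential.
rewrite integral_beta_exponential//; field.
by rewrite gt_eqF ?rising_gt0// pnatr_eq0 -lt0n fact_gt0.
Qed.

End MassFunctions.

(** * Factorial moments *)

Section FactorialMoments.
Context d (T : measurableType d) (R : realType) (P : probability T R).

(** The expectation is an integral against the law of [X], which splits over
    the countably many atoms. *)
Lemma factorial_moment_series (X : {RV P >-> nat}) (p : nat -> R) k :
  has_pmf X p ->
  factorial_moment X k = (\sum_(0 <= x <oo) ((x ^_ k)%:R * p x)%:E)%E.
Proof.
move=> Xp; rewrite /factorial_moment unlock.
pose f (y : nat) : \bar R := (y ^_ k)%:R%:E.
have f0 y : (0 <= f y)%E by rewrite lee_fin.
transitivity (\int[P]_w (f \o X) w)%E.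
  by apply: eq_integral => w _; rewrite ffact_prod.
rewrite -ge0_integral_distribution//.
have -> : [set: nat] = \bigcup_x [set x].
  by apply/seteqP; split => // y _; exists y.
rewrite ge0_integral_bigcup//; last first.
  by move=> i j _ _ [y [/= -> ->]].
apply: eq_eseriesr => x _.
transitivity (\int[distribution P X]_(y in [set x]) (cst (f x) y))%E.
  by apply: eq_integral => y; rewrite inE/= => ->.
by rewrite integral_cst// [X in (_ * X)%E]Xp -EFinM.
Qed.

Lemma waring_factorial_moment (X : {RV P >-> nat}) (m n : R) k :
  0 < m -> k%:R < n - m ->
  has_pmf X (fun x => (n - m) * (rising m x / rising n x.+1)) ->
  factorial_moment X k =
    (rising m k * k`!%:R / \prod_(1 <= j < k.+1) (n - m - j%:R))%:E.
Proof.
move=> m0 kmn Xp; rewrite (factorial_moment_series _ _ k Xp).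
have nm0 : n - m != 0 by rewrite gt_eqF// (le_lt_trans _ kmn).
have mkn : m + k%:R < n by rewrite addrC -ltrBrDr.
apply/cvg_lim => //.
have -> : rising m k * k`!%:R / \prod_(1 <= j < k.+1) (n - m - j%:R) =
   (n - m) * (rising m k * k`!%:R / \prod_(j < k.+1) (n - m - j%:R)).
  rewrite big_ord_recl/= subr0 invfM big_add1/= big_mkord.
  by rewrite [RHS]mulrCA mulVKf.
have -> : (fun N => \sum_(0 <= x < N)
      ((x ^_ k)%:R * ((n - m) * (rising m x / rising n x.+1)))%:E)%E =
    EFin \o (fun N => (n - m) *
      \sum_(x < N) (x ^_ k)%:R * (rising m x / rising n x.+1)).
  apply/funext => N /=; rewrite sumEFin big_mkord mulr_sumr; congr EFin.
  by apply: eq_bigr => x _; rewrite mulrCA.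
apply: cvg_EFin; first exact: nearW.
by apply: cvgMr; exact: waring_ffact_sum_cvg.
Qed.

End FactorialMoments.

Theorem corollary3 (R : realType) (m n : R) (k : nat)
    (beta a b c : R)
    (dX : measure_display) (TX : measurableType dX) (PX : probability TX R)
    (X : {RV PX >-> nat})
    (dY : measure_display) (TY : measurableType dY) (PY : probability TY R)
    (Y : {RV PY >-> nat})
    (m_gt0 : 0 < m) (k_ge1 : (1 <= k)%N) (nm_gtk : k%:R < n - m)
    (beta1 : beta = 1) (a1 : a = 1) (bnm : b = n - m) (c1 : c = 1)
    (X_gnb_be : has_pmf X (gnb_be_pmf m beta a b c))
    (Y_waring : has_pmf Y (waring_pmf m n)) :
  factorial_moment X k = factorial_moment Y k /\
  factorial_moment Y k =
    (ascending_factorial m k * k`!%:R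
      / \prod_(1 <= j < k.+1) (n - m - j%:R))%:E.
Proof.
have mn : m < n by rewrite -subr_gt0 (le_lt_trans _ nm_gtk).
have Xp : has_pmf X (fun x => (n - m) * (rising m x / rising n x.+1)).
  by move=> x; rewrite X_gnb_be beta1 a1 bnm c1 gnb_be_pmfE.
have Yp : has_pmf Y (fun x => (n - m) * (rising m x / rising n x.+1)).
  by move=> x; rewrite Y_waring waring_pmfE.
by rewrite ascending_factorialE// !(@waring_factorial_moment _ _ _ _ _ m n k).
Qed.
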